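(* For every taut set $T\subseteq\mathbb{N}$ there exists a Besicovitch set $B\subseteq\mathbb{N}$ whose tautification is $T$, i.e. $B'=T$.
   Context: $\mathbb{N}=\{1,2,\dots\}$. For $B\subseteq\mathbb{N}$ let $\mathcal{M}_B=\bigcup_{b\in B}b\mathbb{Z}$ be its set of multiples. For $A\subseteq\mathbb{Z}$, the natural density is $d(A)=\lim_{n\to\infty}\frac1n|A\cap[1,n]|$ (if it exists) and the logarithmic density is $\delta(A)=\lim_{n\to\infty}\frac{1}{\ln n}\sum_{1\le k\le n,\,k\in A}\frac1k$; $\delta(\mathcal{M}_B)$ exists for every $B\subseteq\mathbb{N}$ (Davenport--Erdős). $B$ is Besicovitch if $d(\mathcal{M}_B)$ exists. $B$ is taut if $\delta(\mathcal{M}_{B\setminus\{b\}})<\delta(\mathcal{M}_B)$ for every $b\in B$. $B$ is Behrend if $B\subseteq\mathbb{N}\setminus\{1\}$ and $\delta(\mathcal{M}_B)=1$. $B^{prim}=B\setminus\bigcup_{k\ge2}kB$ is the set of elements of $B$ minimal with respect to divisibility. For $c\in\mathbb{N}$ and $A\subseteq\mathbb{N}$, $cA=\{ca:a\in A\}$. Tautification: put $C(B)=\{c\in\mathbb{N}: cA\subseteq B\text{ for some Behrend set }A\}$; the tautification of $B$ is $B'=(B\cup C(B))^{prim}$. (Equivalently, $B'$ is the unique taut set whose Mirsky measure equals that of $B$, where the Mirsky measure of $B$ is the shift-invariant measure on $\{0,1\}^{\mathbb{Z}}$ for which $\mathbf{1}_{\mathbb{Z}\setminus\mathcal{M}_B}$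 is quasi-generic along any sequence realizing the lower density of $\mathcal{M}_B$.) *)

(* Defs.v *)
From mathcomp Require Import all_boot all_order all_algebra.
From mathcomp Require Import all_classical all_reals all_analysis.
Import Order.TTheory GRing.Theory Num.Theory.
Import numFieldNormedType.Exports.

Set Implicit Arguments.
Unset Strict Implicit.
Unset Printing Implicit Defensive.

Local Open Scope classical_set_scope.
Local Open Scope ring_scope.

(* Subsets of {1, 2, ...} are sets of nat included in [posn]; density is
   defined for arbitrary sets of (signed) integers. *)
Definition posn : set nat := [set n | (0 < n)%N].

Definition multiples (B : set nat) : set int :=
  \bigcup_(b in B) [set z | (b%:Z %| z)%Z].

Definition dilate (c : nat) (A : set nat) : set nat :=
  [set (c * a)%N | a in A].

(* The density is a relation between a set and a limit, so that no value is
   attributed to a set whose density does not exist. *)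
Definition has_natural_density (R : realType) (A : set int) (l : R) : Prop :=
  (fun n : nat =>
     (n%:R^-1 * \sum_(1 <= k < n.+1 | `[< A k%:Z >]) 1 : R)) @ \oo --> l.

(* The junk values at n = 0, 1, where ln n = 0, do not affect the limit. *)
Definition has_log_density (R : realType) (A : set int) (l : R) : Prop :=
  (fun n : nat =>
     ((ln n%:R)^-1 * \sum_(1 <= k < n.+1 | `[< A k%:Z >]) k%:R^-1 : R))
    @ \oo --> l.

Definition besicovitch (R : realType) (B : set nat) : Prop :=
  exists l : R, has_natural_density (multiples B) l.

(* By Davenport and Erdos both logarithmic densities exist for every B, and
   they are unique as limits in a Hausdorff space. *)
Definition taut (R : realType) (B : set nat) : Prop :=
  forall b, B b -> exists l1 l2 : R,
    [/\ has_log_density (multiples (B `\ b)) l1,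
        has_log_density (multiples B) l2 & l1 < l2].

Definition behrend (R : realType) (B : set nat) : Prop :=
  B `<=` posn `\ 1%N /\ has_log_density (multiples B) (1 : R).

Definition prim (B : set nat) : set nat :=
  B `\` \bigcup_(k in [set k | (2 <= k)%N]) dilate k B.

Definition behrend_scales (R : realType) (B : set nat) : set nat :=
  [set c | posn c /\ exists A, behrend R A /\ dilate c A `<=` B].

Definition tautification (R : realType) (B : set nat) : set nat :=
  prim (B `|` behrend_scales R B).

(* Main.v *)
(* Take B = {t p : t in T, p a prime > N(t)} with N(t) = t t!.

   Besicovitch: let d be the supremum of the densities of the multiples of
   T_m = {t in T : t <= m}, sets of period m!. If m is maximal with
   N(m) <= n, only elements t <= m of T contribute to M_B in [1, n], whence
   |M_B cap [1, n]| <= n d + m! <= n d + n/m. Conversely, for fixed m, the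
   multiples of T_m outside M_B have all their prime factors <= N(m), so
   they have density 0.

   Tautification: the primes > N(t) form a Behrend set, so T is contained in
   C(B). Let c A be contained in B with A Behrend, and suppose that no
   element of T divides c. Each a in A either has a divisor in
   E = {e : c e in T}, or satisfies c a = t p with p | c, and then a <= t < c.
   Sieving out finitely many integers > 1 does not affect whether the
   surviving set has logarithmic density 0, so the integers free of divisors
   in E \ {e} have density 0 for every e in E. Hence almost every multiple of
   c e is a multiple of another element of T, so T is not taut. *)

Require Import Defs.
From mathcomp Require Import all_boot all_order all_algebra.
From mathcomp Require Import all_classical all_reals all_analysis.
From mathcomp Require Import lra.
Import Order.TTheory GRing.Theory Num.Theory.
Import numFieldNormedType.Exports.

Set Implicit Arguments.
Unset Strict Implicit.
Unset Printing Implicit Defensive.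

Local Open Scope classical_set_scope.

(** * Weighted sums over sets of positive integers, and null sets *)

Section WeightedSums.
Local Open Scope ring_scope.
Variable R : realType.
Implicit Types (w : nat -> R) (S : set nat).

(** The weight is a parameter so that counting (weight 1) and logarithmic sums (weight 1/k) share
    their lemmas. Summation starts at 1, so membership of 0 never matters. *)
Definition wsum w S n : R := \sum_(1 <= k < n.+1 | `[< S k >]) w k.

Lemma wsum0 w S : wsum w S 0 = 0.
Proof. by rewrite /wsum big_geq. Qed.

Lemma wsumS w S n :
  wsum w S n.+1 = wsum w S n + (if `[< S n.+1 >] then w n.+1 else 0).
Proof.
by rewrite /wsum big_mkcond big_nat_recr //= -big_mkcond.
Qed.

Lemma wsum_ge0 w S n : (forall k, 0 <= w k) -> 0 <= wsum w S n.
Proof. by move=> w0; apply: sumr_ge0. Qed.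

Lemma wsumU_le w S S1 S2 n : (forall k, 0 <= w k) ->
  (forall k, (0 < k)%N -> S k -> S1 k \/ S2 k) ->
  wsum w S n <= wsum w S1 n + wsum w S2 n.
Proof.
move=> w0 SU; elim: n => [|n IHn]; first by rewrite !wsum0 addr0.
rewrite !wsumS addrACA lerD //.
case: (asboolP (S n.+1)) => [/(SU n.+1 isT) Sn|_].
  by case: asboolP => Sn1; case: asboolP => Sn2; rewrite ?addr0 ?add0r ?lerDl //;
    case: Sn.
by apply: addr_ge0; case: ifP.
Qed.

Lemma wsum_le w S S' n : (forall k, 0 <= w k) ->
  (forall k, (0 < k <= n)%N -> S k -> S' k) -> wsum w S n <= wsum w S' n.
Proof.
move=> w0; elim: n => [|n IHn] SS'; first by rewrite !wsum0.
rewrite !wsumS lerD //.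
  by apply: IHn => k /andP[k0 kn]; apply: SS'; rewrite k0 leqW.
case: (asboolP (S n.+1)) => [/(SS' n.+1 (leqnn _)) Sn|_]; first by rewrite asboolT.
by case: ifP.
Qed.

Lemma wsumC w S n : wsum w S n + wsum w (~` S) n = wsum w setT n.
Proof.
elim: n => [|n IHn]; first by rewrite !wsum0 addr0.
rewrite !wsumS addrACA IHn; congr (_ + _).
by rewrite asbool_neg (asboolT (_ : setT n.+1)) //; case: asboolP; rewrite (addr0, add0r).
Qed.

(** As n grows, [n %/ b] increases exactly at the multiples of b, so both sides gain the same
    terms. *)
Lemma wsum_dilate w S b n : (0 < b)%N ->
  wsum w [set k | (b %| k)%N /\ S (k %/ b)%N] n
  = wsum (fun k => w (b * k)%N) S (n %/ b).
Proof.
move=> b0; elim: n => [|n IHn]; first by rewrite div0n !wsum0.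
rewrite wsumS IHn divnS //; case: (boolP (b %| n.+1)%N) => bn /=; last first.
  by rewrite add0n asboolF ?addr0 //= (negbTE bn) => -[].
have En : ((n %/ b).+1 = n.+1 %/ b)%N by rewrite divnS // bn.
rewrite add1n wsumS En mulnC divnK //; congr (_ + _).
by congr (if _ then _ else _); apply: asbool_equiv_eq; split=> [[]|].
Qed.

Definition countsum S n : R := wsum (fun=> 1) S n.

Lemma countsum_le S n : countsum S n <= n%:R.
Proof.
elim: n => [|n IHn]; first by rewrite /countsum wsum0.
by rewrite /countsum wsumS -natr1 lerD //; case: ifP.
Qed.

(** Splitting a full period off n leaves the difference unchanged; once n < P, both of its terms lie
    in [0, P]. *)
Lemma countsum_periodic S P : (0 < P)%N -> (forall k, S (P + k)%N <-> S k) ->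
  forall n, `|countsum S n - n%:R * (countsum S P / P%:R)| <= P%:R.
Proof.
move=> P0 SP.
have PR : 0 < P%:R :> R by rewrite ltr0n.
have shift n : countsum S (P + n) = countsum S P + countsum S n.
  rewrite /countsum; elim: n => [|n IHn]; first by rewrite addn0 wsum0 addr0.
  rewrite addnS !wsumS IHn addrA; congr (_ + _).
  by congr (if _ then _ else _); apply: asbool_equiv_eq; rewrite -addnS.
elim/ltn_ind => n IHn; case: (ltnP n P) => nP.
  have d0 : 0 <= countsum S P / P%:R by rewrite divr_ge0 ?wsum_ge0.
  have d1 : countsum S P / P%:R <= 1 by rewrite ler_pdivrMr // mul1r countsum_le.
  have n0 : 0 <= n%:R :> R by [].
  have nPR : n%:R <= P%:R :> R by rewrite ler_nat ltnW.
  have := countsum_le S n; have : 0 <= countsum S n by apply: wsum_ge0.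
  rewrite ler_norml; nra.
rewrite -(subnKC nP) shift natrD mulrDl mulrCA divff ?gt_eqF // mulr1.
by rewrite opprD addrACA subrr add0r IHn // ltn_subrL P0 (leq_trans P0).
Qed.

Definition logsum S n : R := wsum (fun k => k%:R^-1) S n.

Definition log_null S : Prop :=
  (fun n => (ln n%:R)^-1 * logsum S n) @ \oo --> (0 : R).

(** Natural density 0: counts are nonnegative, so an eventual upper bound suffices. *)
Definition nat_null S : Prop :=
  forall eps : R, 0 < eps ->
  \forall n \near \oo, countsum S n <= eps * n%:R.

Lemma inv_natr_ge0 (k : nat) : 0 <= k%:R^-1 :> R.
Proof. by rewrite invr_ge0. Qed.

Lemma ln_inv_ge0 n : 0 <= (ln n%:R)^-1 :> R.
Proof.
rewrite invr_ge0; case: n => [|n]; first by rewrite ln0.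
by rewrite ln_ge0 // ler1n.
Qed.

Lemma logsum_ge0 S n : 0 <= logsum S n.
Proof. exact: wsum_ge0 inv_natr_ge0. Qed.

Lemma log_null_squeeze S (u : nat -> R) : u @ \oo --> 0 ->
  (forall n, (ln n%:R)^-1 * logsum S n <= u n) -> log_null S.
Proof.
move=> u0 Su; apply: (squeeze_cvgr _ (cvg_cst 0) u0).
by near=> n; rewrite Su mulr_ge0 ?logsum_ge0 ?ln_inv_ge0.
Unshelve. all: by end_near. Qed.

Lemma log_nullU S S1 S2 : (forall k, (0 < k)%N -> S k -> S1 k \/ S2 k) ->
  log_null S1 -> log_null S2 -> log_null S.
Proof.
move=> SU S1null S2null.
apply: (@log_null_squeeze _ (fun n =>
  (ln n%:R)^-1 * logsum S1 n + (ln n%:R)^-1 * logsum S2 n)).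
  by rewrite -[0]addr0; apply: cvgD.
move=> n; rewrite -mulrDr ler_wpM2l ?ln_inv_ge0 // wsumU_le //.
Qed.

Lemma log_null_sub S S' : (forall k, (0 < k)%N -> S k -> S' k) ->
  log_null S' -> log_null S.
Proof. by move=> SS' S'0; apply: (log_nullU _ S'0 S'0) => k k0 /(SS' _ k0); left. Qed.

(** Writing k = b j gives 1/k = (1/b)(1/j); lengthening the range of j from n/b to n only adds
    nonnegative terms. *)
Lemma logsum_dilate_le S b n : (0 < b)%N ->
  logsum [set k | (b %| k)%N /\ S (k %/ b)%N] n <= b%:R^-1 * logsum S n.
Proof.
move=> b0; rewrite /logsum wsum_dilate //.
have -> : wsum (fun k => ((b * k)%N%:R)^-1) S (n %/ b)
          = b%:R^-1 * logsum S (n %/ b)%N :> R.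
  by rewrite /logsum /wsum mulr_sumr; apply: eq_bigr => k _; rewrite natrM invfM.
rewrite ler_wpM2l ?inv_natr_ge0 // /logsum /wsum.
rewrite [leRHS](@big_cat_nat _ _ _ (n %/ b).+1) //=; last by rewrite ltnS leq_div.
by rewrite lerDl sumr_ge0 // => k _; apply: inv_natr_ge0.
Qed.

Lemma log_null_dilate S b : (0 < b)%N -> log_null S ->
  log_null [set k | (b %| k)%N /\ S (k %/ b)%N].
Proof.
move=> b0 S0; apply: (log_null_squeeze S0) => n.
rewrite ler_wpM2l ?ln_inv_ge0 //; apply: le_trans (logsum_dilate_le _ _ b0) _.
by rewrite ler_piMl ?logsum_ge0 // invf_le1 ?ltr0n // ler1n.
Qed.

(* If S_0 is the part of S outside b Z, then S is contained in S_0 u b S, so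
   the logarithmic sums satisfy L_S(n) <= L_{S_0}(n) + L_S(n) / b. *)
Lemma log_null_sieve S b : (1 < b)%N -> (forall k, S (b * k)%N -> S k) ->
  log_null [set k | S k /\ ~~ (b %| k)%N] -> log_null S.
Proof.
move=> b1 Sb S0null; have b0 := ltnW b1.
have dec n : logsum S n <= 2 * logsum [set k | S k /\ ~~ (b %| k)%N] n.
  have : logsum S n <= logsum [set k | S k /\ ~~ (b %| k)%N] n
                       + logsum [set k | (b %| k)%N /\ S (k %/ b)%N] n.
    apply: wsumU_le => [|k _ Sk]; first exact: inv_natr_ge0.
    case: (boolP (b %| k)%N) => bk; [right|by left].
    by split=> //; apply: Sb; rewrite mulnC divnK.
  have := logsum_dilate_le S n b0.
  have b2 : b%:R^-1 <= 2^-1 :> R by rewrite lef_pV2 ?posrE ?ltr0n // ler_nat.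
  have : b%:R^-1 * logsum S n <= 2^-1 * logsum S n by rewrite ler_wpM2r ?logsum_ge0.
  lra.
apply: (@log_null_squeeze _ (fun n =>
  2 * ((ln n%:R)^-1 * logsum [set k | S k /\ ~~ (b %| k)%N] n))).
  by rewrite -[0](mulr0 2); apply: cvgMl_tmp.
by move=> n; rewrite mulrCA ler_wpM2l ?ln_inv_ge0 // dec.
Qed.

(* With the same decomposition, |S cap [1, n]| <= |S_0 cap [1, n]| +
   |S cap [1, n/b]|; the additive constant N absorbs the small values of n. *)
Lemma nat_null_sieve S b : (1 < b)%N -> (forall k, S (b * k)%N -> S k) ->
  nat_null [set k | S k /\ ~~ (b %| k)%N] -> nat_null S.
Proof.
move=> b1 Sb S0null e e0; have b0 := ltnW b1.
have [N _ HN] := S0null (e / 4) (divr_gt0 e0 (ltr0n _ 4)).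
have bound n : countsum S n <= e / 2 * n%:R + N%:R.
  elim/ltn_ind: n => n IHn.
  have n_ge0 : 0 <= n%:R :> R by [].
  case: (ltnP n N) => nN.
    apply: le_trans (countsum_le S n) _; apply: ler_wpDl; last by rewrite ler_nat ltnW.
    by rewrite mulr_ge0 // divr_ge0 // ltW.
  case: (posnP n) => [->|n0].
    by rewrite /countsum wsum0 mulr0 add0r.
  have := HN n nN; rewrite /= => Sn.
  have : countsum S n <= countsum [set k | S k /\ ~~ (b %| k)%N] n
                  + countsum [set k | (b %| k)%N /\ S (k %/ b)%N] n.
    apply: wsumU_le => // k _ Sk.
    case: (boolP (b %| k)%N) => bk; [right|by left].
    by split=> //; apply: Sb; rewrite mulnC divnK.
  rewrite {3}/countsum wsum_dilate // -/(countsum S (n %/ b)%N).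
  have := IHn _ (ltn_Pdiv b1 n0).
  have : (n %/ b)%:R <= 2^-1 * n%:R :> R.
    rewrite mulrC ler_pdivlMr // -natrM ler_nat.
    by apply: leq_trans (leq_trunc_div n b); rewrite leq_mul2l b1 orbT.
  nra.
near=> n.
apply: le_trans (bound n) _.
suff : N%:R <= e / 2 * n%:R by lra.
rewrite mulrC -ler_pdivrMr ?divr_gt0 //.
near: n.
exact: nbhs_infty_ger.
Unshelve. all: by end_near. Qed.

End WeightedSums.

(** * Harmonic sums and logarithmic density *)

Section LogDensity.
Local Open Scope ring_scope.
Variable R : realType.
Implicit Types S : set nat.

(** The increment of the logarithm is ln (1 + 1/(n+1)) <= 1/(n+1). *)
Lemma logsum_setT_ge n : ln n.+1%:R <= logsum R setT n.
Proof.
elim: n => [|n IHn]; first by rewrite ln1 logsum_ge0.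
rewrite /logsum wsumS asboolT //.
have n0 : 0 < n.+1%:R :> R by rewrite ltr0n.
have -> : n.+2%:R = n.+1%:R * (1 + n.+1%:R^-1) :> R.
  by rewrite mulrDr mulr1 divff ?gt_eqF // natr1.
have i0 : 0 < n.+1%:R^-1 :> R by rewrite invr_gt0.
rewrite lnM ?posrE ?addr_gt0 // lerD //.
by apply: le_ln1Dx; apply: lt_trans i0; rewrite ltrN10.
Qed.

Lemma logsum_setT_le n : (0 < n)%N -> logsum R setT n <= 1 + ln n%:R.
Proof.
case: n => // n _; elim: n => [|n IHn].
  by rewrite ln1 addr0 /logsum wsumS wsum0 add0r asboolT // invr1.
rewrite /logsum wsumS asboolT // -/(logsum R setT n.+1).
have n1 : 0 < n.+1%:R :> R by rewrite ltr0n.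
have n2 : 0 < n.+2%:R :> R by rewrite ltr0n.
(* With this factorization, ln (1 + x) <= x at x = -1/(n+2) bounds the new term by the increment of
   the logarithm. *)
have En : n.+1%:R = n.+2%:R * (1 - n.+2%:R^-1) :> R.
  by rewrite mulrBr mulr1 divff ?gt_eqF // -(natr1 n.+1) addrK.
have i1 : n.+2%:R^-1 < 1 :> R by rewrite invf_lt1 // ltr1n.
have h0 : 0 < 1 - n.+2%:R^-1 :> R by rewrite subr_gt0.
have : ln n.+1%:R = ln n.+2%:R + ln (1 - n.+2%:R^-1) :> R.
  by rewrite {1}En lnM ?posrE.
have : ln (1 - n.+2%:R^-1) <= - n.+2%:R^-1 :> R by apply: le_ln1Dx; rewrite ltrN2.
by move: (n.+2%:R^-1) => x *; lra.
Qed.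

Lemma ln_inv_cvg0 : (fun n => (ln n%:R)^-1) @ \oo --> (0 : R).
Proof.
apply/(gtr0_cvgV0 (f := fun n => ln n%:R)).
  by near=> n; rewrite ln_gt0 // ltr1n; near: n; exact: nbhs_infty_gt.
apply/cvgryPge => A; near=> n.
have An : expR A <= n%:R by near: n; exact: nbhs_infty_ger.
rewrite -[A]expRK ler_ln ?posrE ?expR_gt0 //.
exact: lt_le_trans (expR_gt0 A) An.
Unshelve. all: by end_near. Qed.

Lemma logsum_setT_cvg1 :
  (fun n => (ln n%:R)^-1 * logsum R setT n) @ \oo --> (1 : R).
Proof.
have lim1 : (fun n => (ln n%:R)^-1 + 1) @ \oo --> (1 : R).
  by rewrite -[X in _ --> X]add0r; apply: cvgD ln_inv_cvg0 (cvg_cst _).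
apply: (@squeeze_cvgr _ _ _ _ (fun=> 1) _ _ _ 1 _ lim1); last exact: cvg_cst.
near=> n.
have n1 : (1 < n)%N by near: n; exact: nbhs_infty_gt.
have n0 := ltnW n1.
have l0 : 0 < ln n%:R :> R by rewrite ln_gt0 // ltr1n.
have lw : ln n%:R <= ln n.+1%:R :> R by rewrite ler_ln ?posrE ?ltr0n // ler_nat.
rewrite mulrC ler_pdivlMr // mul1r ler_pdivrMr // mulrDl mul1r mulVf ?gt_eqF //.
by rewrite (le_trans lw (logsum_setT_ge _)) logsum_setT_le.
Unshelve. all: by end_near. Qed.

(** The normalized harmonic sum over all integers tends to 1, and it splits into the sums over A and
    over its complement. *)
Lemma log_density1P (A : set int) :
  has_log_density A (1 : R) <-> log_null R [set k | ~ A k%:Z].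
Proof.
pose S := [set k | A k%:Z].
have SC : logsum R [set k | ~ A k%:Z] = logsum R setT \- logsum R S.
  by apply/funext => n /=; rewrite /logsum -(wsumC _ S) addrAC subrr add0r.
split=> lim.
  rewrite /log_null SC (_ : (fun n => _) = fun n =>
    (ln n%:R)^-1 * logsum R setT n - (ln n%:R)^-1 * logsum R S n); last first.
    by apply/funext => n; rewrite mulrBr.
  by rewrite -[X in _ --> X](subrr 1); apply: cvgB logsum_setT_cvg1 lim.
rewrite /has_log_density.
have ES n : logsum R S n = logsum R setT n - logsum R [set k | ~ A k%:Z] n.
  by rewrite SC /= subKr.
rewrite (_ : (fun n => _) = fun n => (ln n%:R)^-1 * logsum R setT n
    - (ln n%:R)^-1 * logsum R [set k | ~ A k%:Z] n); last first.
  by apply/funext => n; rewrite -mulrBr -ES.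
by rewrite -[X in _ --> X](subr0 1); apply: cvgB logsum_setT_cvg1 lim.
Qed.

Lemma log_density_le (A B : set int) (l1 l2 : R) :
  has_log_density A l1 -> has_log_density B l2 ->
  log_null R [set k | B k%:Z /\ ~ A k%:Z] -> l2 <= l1.
Proof.
move=> Al1 Bl2 BA0.
have lim := cvgD Al1 BA0; rewrite addr0 in lim.
apply: (ler_cvg_to Bl2 (lim _)).
near=> n; rewrite /= -mulrDr ler_wpM2l ?ln_inv_ge0 //.
apply: (@wsumU_le R _ [set k | B k%:Z] [set k | A k%:Z]) => [k|k _ Bk].
  exact: inv_natr_ge0.
by case: (pselect (A k%:Z)) => Ak; [left|right].
Unshelve. all: by end_near. Qed.

End LogDensity.

(** * Sieving by finitely many integers, and smooth numbers *)

Section Sieve.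
Variable R : realType.
Implicit Types S E : set nat.

Definition unsieved E : set nat := [set k | forall e, E e -> ~~ (e %| k)].

(** [null] is abstract so that one induction serves both densities. Each step drops the largest
    additional sieving integer, which is allowed because an unsieved set contains k whenever it
    contains b k. *)
Lemma sieve_finite (null : set nat -> Prop) :
  (forall S S', S `<=` S' -> null S' -> null S) ->
  (forall S b, 1 < b -> (forall k, S (b * k) -> S k) ->
    null [set k | S k /\ ~~ (b %| k)] -> null S) ->
  forall E K, null (unsieved (E `|` [set e | 1 < e < K])) -> null (unsieved E).
Proof.
move=> null_sub null_sieve E; elim=> [|K IHK].
  by apply: null_sub => k Ek e [|/andP[_]//]; exact: Ek.
move=> EK; apply: IHK; case: (ltnP 1 K) => K1; last first.
  apply: null_sub EK => k Ek e [Ee|/andP[e1 eK]]; apply: Ek; first by left.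
  by have := leq_trans e1 (leq_trans (eK : e <= K) K1); rewrite ltnn.
apply: (null_sieve _ K K1) => [k Ek e Ee|].
  by apply: contra (Ek e Ee) => /dvdn_mull; apply.
apply: null_sub EK => k /= [Ek Kk] e [Ee|/andP[e1]]; first by apply: Ek; left.
rewrite ltnS leq_eqVlt => /orP[/eqP-> //|eK].
by apply: Ek; right; rewrite /= e1.
Qed.

Lemma log_null_sieve_finite E K :
  log_null R (unsieved (E `|` [set e | 1 < e < K])) -> log_null R (unsieved E).
Proof.
apply: sieve_finite => [S S' SS'|]; last exact: log_null_sieve.
by apply: log_null_sub => k _; exact: SS'.
Qed.

Lemma nat_null_sub S S' : (forall k, 0 < k -> S k -> S' k) ->
  nat_null R S' -> nat_null R S.
Proof.
move=> SS' S'0 e e0; near=> n.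
apply: (@le_trans _ _ (countsum R S' n)).
  by apply: wsum_le => // k /andP[k0 _]; exact: SS'.
by near: n; exact: S'0.
Unshelve. all: by end_near. Qed.

Lemma wsum_set1_le (w : nat -> R) n : (0 <= w 1)%R ->
  (wsum w [set 1] n <= w 1)%R.
Proof.
move=> w0; case: n => [|n]; first by rewrite wsum0.
elim: n => [|n IHn]; first by rewrite wsumS wsum0 add0r asboolT.
by rewrite wsumS asboolF // addr0.
Qed.

Lemma rough_cover N k : 0 < k ->
  unsieved ([set p | prime p /\ N < p] `|` [set e | 1 < e < N.+1]) k -> k = 1.
Proof.
move=> k0 Uk; case: (ltnP 1 k) => [k1|]; last by case: k k0 {Uk} => [|[]].
have pk := pdiv_prime k1; have := Uk (pdiv k); rewrite pdiv_dvd => /(_ _)/negP[] //.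
by case: (ltnP N (pdiv k)) => Np; [left|right; rewrite /= prime_gt1].
Qed.

(** Sieving out 2, ..., N as well leaves only 1 among the positive integers. So the primes above N
    are seen to form a Behrend set without the divergence of the sum of their reciprocals. *)
Lemma log_null_smooth N : log_null R (unsieved [set p | prime p /\ N < p]).
Proof.
apply: (@log_null_sieve_finite _ N.+1).
apply: (@log_null_sub _ _ [set 1] (@rough_cover N)).
apply: (log_null_squeeze (@ln_inv_cvg0 R)) => n.
apply: ler_piMr; first exact: ln_inv_ge0.
by rewrite (le_trans (wsum_set1_le _ _)) ?inv_natr_ge0 // invr1.
Qed.

Lemma nat_null_smooth N : nat_null R (unsieved [set p | prime p /\ N < p]).
Proof.
apply: (@sieve_finite (@nat_null R) _ (@nat_null_sieve R) _ N.+1).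
  by move=> S S' SS'; apply: nat_null_sub => k _; exact: SS'.
apply: (nat_null_sub (@rough_cover N)) => e e0; near=> n.
apply: le_trans (wsum_set1_le _ _) _ => //.
rewrite mulrC -ler_pdivrMr // mul1r; near: n; exact: nbhs_infty_ger.
Unshelve. all: by end_near. Qed.

End Sieve.

(** * The prime multiples of a set and their natural density *)

Section PrimeMultiples.
Variable R : realType.
Implicit Types T B : set nat.

Lemma multiplesP B (k : nat) : multiples B (Posz k) <-> exists2 b, B b & b %| k.
Proof. by split=> -[b Bb bk]; exists b => //; move: bk; rewrite /= dvdzE. Qed.

Definition prime_multiples T : set nat :=
  [set n | exists t p, [/\ T t, prime p, t * t`! < p & n = t * p]].

Definition initial_multiples T m : set nat :=
  [set k | exists t, [/\ T t, t <= m & t %| k]].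

Definition initial_density T m : R :=
  (countsum R (initial_multiples T m) m`! / m`!%:R)%R.

Lemma countsum_initial T m n : T `<=` posn ->
  (`|countsum R (initial_multiples T m) n - n%:R * initial_density T m|
     <= m`!%:R)%R.
Proof.
move=> T_pos; apply: countsum_periodic => [|k]; first exact: fact_gt0.
split=> -[t [Tt tm tk]]; exists t; split=> //; move: tk;
  by rewrite dvdn_addr // dvdn_fact // tm andbT; exact: T_pos.
Qed.

(** A divisor t p of k satisfies t t! < p <= k <= n, which forces t <= m. *)
Lemma prime_multiples_bounded T n m k :
  (forall i, i * i`! <= n -> i <= m) -> 0 < k <= n ->
  multiples (prime_multiples T) (Posz k) -> initial_multiples T m k.
Proof.
move=> m_max /andP[k0 kn] /multiplesP[_ [t [p [Tt p_pr tp ->]]] tpk].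
exists t; split=> //; last exact: dvdn_trans (dvdn_mulr _ (dvdnn t)) tpk.
apply: m_max; apply: leq_trans (ltnW tp) (leq_trans _ kn).
by apply: dvdn_leq k0 (dvdn_trans (dvdn_mull _ (dvdnn p)) tpk).
Qed.

(** A prime p > m m! dividing k exceeds t, hence is coprime to t, so that t p divides k. *)
Lemma initial_multiples_rough T m k : T `<=` posn -> initial_multiples T m k ->
  multiples (prime_multiples T) (Posz k) \/
  unsieved [set p | prime p /\ m * m`! < p] k.
Proof.
move=> T_pos [t [Tt tm tk]].
case: (pselect (exists2 p, prime p /\ m * m`! < p & p %| k)) => [[p [p_pr mp] pk]|nop].
  left; apply/multiplesP; exists (t * p).
    exists t, p; split=> //; apply: leq_ltn_trans mp.
    by rewrite leq_mul // leq_fact.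
  rewrite Gauss_dvd ?tk // coprime_sym prime_coprime //.
  apply/negP => /(dvdn_leq (T_pos _ Tt)) pt.
  have := leq_trans mp (leq_trans pt tm).
  by rewrite ltnNge leq_pmulr // fact_gt0.
by right=> p pP; apply/negP => pk; apply: nop; exists p.
Qed.

Lemma prime_multiples_besicovitch T : T `<=` posn ->
  besicovitch R (prime_multiples T).
Proof.
move=> T_pos; set D := range (initial_density T).
have D_le1 : ubound D 1%R.
  move=> _ [m _ <-]; rewrite /initial_density ler_pdivrMr ?ltr0n ?fact_gt0 //.
  by rewrite mul1r countsum_le.
have D_sup : has_sup D by split; [exists (initial_density T 0), 0|exists 1%R].
exists (sup D); rewrite /has_natural_density.
pose S := [set k | multiples (prime_multiples T) (Posz k)].
rewrite (_ : (fun n => _) = fun n => (n%:R^-1 * countsum R S n)%R) //.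
apply/cvgrPdist_le => e e0.
(* The lower bound loses e/3 three times: in approximating the supremum, in the smooth remainder and
   in the periodicity error m!. *)
have e3 : (0 < e / 3)%R by rewrite divr_gt0.
have [_ [m _ <-] Dm] := sup_adherent e3 D_sup.
near=> n.
have n0 : (0 < n%:R :> R)%R.
  by rewrite ltr0n; near: n; exact: nbhs_infty_gt.
have lower : (n%:R * (sup D - e) <= countsum R S n)%R.
  have : (countsum R (initial_multiples T m) n <= countsum R S n
          + countsum R (unsieved [set p | prime p /\ (m * m`! < p)%N]) n)%R.
    by apply: wsumU_le => // k _; exact: initial_multiples_rough.
  have : (countsum R (unsieved [set p | prime p /\ (m * m`! < p)%N]) n <= e / 3 * n%:R)%R.
    by near: n; exact: nat_null_smooth.
  have : (m`!%:R <= e / 3 * n%:R :> R)%R.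
    rewrite mulrC -ler_pdivrMr //; near: n; exact: nbhs_infty_ger.
  have := countsum_initial m n T_pos; rewrite ler_norml => /andP[+ _].
  have : (n%:R * (sup D - e / 3) <= n%:R * initial_density T m)%R.
    by rewrite ler_pM2l // ltW.
  lra.
have upper : (countsum R S n <= n%:R * (sup D + e))%R.
  (* This makes the maximal q satisfy q >= M >= 1/e, whence q! <= e q q! <= e n. *)
  have [M Mn Me] : exists2 M, M * M`! <= n & (e^-1 <= M%:R)%R.
    exists (Num.truncn e^-1).+1; last by rewrite ltW // truncnS_gt.
    by near: n; exact: nbhs_infty_ge.
  have m_ex : exists i, i * i`! <= n by exists M.
  have m_le i : i * i`! <= n -> i <= n.
    by apply: leq_trans; rewrite leq_pmulr // fact_gt0.
  case: (ex_maxnP m_ex m_le) => q qn q_max.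
  have : (countsum R S n <= countsum R (initial_multiples T q) n)%R.
    by apply: wsum_le => // k kn; apply: prime_multiples_bounded kn.
  have := countsum_initial q n T_pos; rewrite ler_norml => /andP[_].
  have : (n%:R * initial_density T q <= n%:R * sup D)%R.
    by rewrite ler_pM2l //; apply: ub_le_sup; [case: D_sup|exists q].
  have : (q`!%:R <= n%:R * e :> R)%R.
    rewrite -ler_pdivrMr // mulrC; apply: le_trans (_ : (q * q`!)%N%:R <= _)%R; last by rewrite ler_nat.
    by rewrite natrM ler_wpM2r // (le_trans Me) // ler_nat q_max.
  lra.
rewrite mulrC ler_distlC.
by rewrite ler_pdivlMr // ler_pdivrMr // [(_ * n%:R)%R]mulrC lower mulrC upper.
Unshelve. all: by end_near. Qed.

(** * Taut sets, Behrend sets and the tautification *)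

Lemma taut_not_null T t : taut R T -> T t ->
  ~ log_null R [set k | multiples T (Posz k) /\ ~ multiples (T `\ t) (Posz k)].
Proof.
move=> Ttaut Tt Tnull; have [l1 [l2 [L1 L2]]] := Ttaut t Tt.
by rewrite ltNge (log_density_le L1 L2 Tnull).
Qed.

Lemma taut_primitive T t t' : taut R T -> T t -> T t' -> t' %| t -> t' = t.
Proof.
move=> Ttaut Tt Tt' t't; apply: contrapT => tt'.
(* The set in question is empty, as multiples of t are multiples of t'; the smooth numbers serve as
   a null set containing it. *)
apply: (taut_not_null Ttaut Tt); apply: (log_null_sub _ (@log_null_smooth R 0)) => k _.
move=> [/multiplesP[b Tb bk]] []; apply/multiplesP.
case: (eqVneq b t) => [bt|/eqP bt]; last by exists b.
by exists t' => //; apply: dvdn_trans t't _; rewrite -bt.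
Qed.

Lemma behrend_large_primes N : behrend R [set p | prime p /\ N < p].
Proof.
split=> [p [p_pr _]|].
  by split; [exact: prime_gt0|move=> p1; move: p_pr; rewrite p1].
apply/log_density1P; apply: (log_null_sub _ (@log_null_smooth R N)) => k _ Mk p pP.
by apply/negP => pk; apply: Mk; apply/multiplesP; exists p.
Qed.

Lemma behrend_unsieved_null A : behrend R A -> log_null R (unsieved A).
Proof.
move=> [_ /log_density1P]; apply: log_null_sub => k _ Ak /multiplesP[a Aa ak].
by have := Ak a Aa; rewrite ak.
Qed.

Lemma log_null_setT : ~ log_null R setT.
Proof.
move=> T0; have E01 : 0%R = 1%R :> R := cvg_unique (@Rhausdorff R) T0 (@logsum_setT_cvg1 R).
by have := @ltr01 R; rewrite -E01 ltxx.
Qed.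

Lemma behrend_scales_prime_multiples T c : T `<=` posn -> taut R T ->
  behrend_scales R (prime_multiples T) c -> exists2 t, T t & t %| c.
Proof.
move=> T_pos T_taut [c0 [A [A_beh cA]]]; apply: contrapT => nTc.
pose E := [set e | T (c * e)].
have E_gt1 e : E e -> 1 < e.
  case: e => [/T_pos|[|//] Tc]; first by rewrite muln0.
  by case: nTc; exists c => //; move: Tc; rewrite /E /= muln1.
have A_cover a : A a -> exists2 e, (E `|` [set e | 1 < e < c]) e & e %| a.
  move=> Aa; have [/= a0 a1] := A_beh.1 a Aa.
  have [|t [p [Tt p_pr tp]]] := cA (c * a); first by exists a.
  have p0 := prime_gt0 p_pr.
  (* If p does not divide c, then c divides t and t/c is in [E]. Otherwise a divides t, and a <= t <
     p <= c. *)
  move=> cae; case: (boolP (p %| c)) => pc; last first.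
    have ct : c %| t.
      rewrite -(@Gauss_dvdl _ _ p) 1?coprime_sym ?prime_coprime //.
      by rewrite -cae dvdn_mulr.
    exists (t %/ c); first by left; rewrite /E /= mulnC divnK.
    rewrite -(@dvdn_pmul2l c) // cae mulnC divnK // dvdn_mulr //.
  exists a => //; right; rewrite /= ltn_neqAle eq_sym a0 andbT.
  apply/andP; split; first exact/eqP.
  have at_ : a %| t.
    by rewrite -(@dvdn_pmul2r p) // -cae mulnC dvdn_mul.
  apply: leq_ltn_trans (dvdn_leq (T_pos _ Tt) at_) _.
  apply: leq_ltn_trans (leq_trans tp (dvdn_leq c0 pc)).
  by rewrite leq_pmulr // fact_gt0.
have EA_null : log_null R (unsieved (E `|` [set e | 1 < e < c])).
  apply: (log_null_sub _ (behrend_unsieved_null A_beh)) => k _ Ek a Aa.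
  have [e Ee ea] := A_cover a Aa.
  by apply: contra (Ek e Ee); exact: dvdn_trans.
(* If [E] were empty, [unsieved E] would contain every integer. *)
have [e Ee] : exists e, E e.
  apply: contrapT => nE; apply: log_null_setT.
  apply: (log_null_sub _ (log_null_sieve_finite EA_null)) => k _ _ e Ee.
  by case: nE; exists e.
apply: (@taut_not_null T (c * e) T_taut Ee).
have E'_null : log_null R (unsieved (E `\ e)).
  (* The bound exceeds e, so that e counts among the finitely many integers that may be dropped. *)
  apply: (@log_null_sieve_finite _ _ (maxn c e.+1)).
  apply: (log_null_sub _ EA_null) => k _ Ek f [Ef|/andP[f1 fc]]; last first.
    by apply: Ek; right; rewrite /= f1 leq_max fc.
  case: (eqVneq f e) => [fe|/eqP fe]; last by apply: Ek; left.
  by apply: Ek; right; rewrite /= fe leq_max ltnSn orbT E_gt1.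
(* A multiple of c e avoiding all other elements of T is c j with j free of divisors in [E] other
   than e. *)
apply: (log_null_sub _ (log_null_dilate c0 E'_null)) => k _.
move=> [/multiplesP[t Tt tk] nTk].
have no_t s : T s -> s <> c * e -> ~~ (s %| k).
  by move=> Ts se; apply/negP => sk; apply: nTk; apply/multiplesP; exists s.
have te : t = c * e by apply: contrapT => /(no_t t Tt); rewrite tk.
have ck : c %| k by apply: dvdn_trans tk; rewrite te dvdn_mulr.
split=> // f [Ef fe].
rewrite -(@dvdn_pmul2l c) // [c * (k %/ c)]mulnC divnK //; apply: no_t => //.
by move/eqP; rewrite eqn_pmul2l // => /eqP.
Qed.

(** If t = k x with x in X, some s in T divides x and hence t, so s = t by primitivity; then t <= x,
    which excludes k >= 2. *)
Lemma prim_eq T X : T `<=` posn ->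
  (forall t t', T t -> T t' -> t' %| t -> t' = t) -> T `<=` X ->
  (forall x, X x -> 0 < x /\ exists2 t, T t & t %| x) -> prim X = T.
Proof.
move=> T_pos T_prim TX XT; apply/seteqP; split=> [x [Xx xmin]|t Tt].
  have [x0 [t Tt /dvdnP[k xk]]] := XT x Xx.
  case: k xk => [x00|[|k] xk]; first by rewrite x00 in x0.
    by rewrite xk mul1n.
  by case: xmin; exists k.+2 => //; exists t => //; exact: TX.
split=> [|[k /= k2 [x Xx kxt]]]; first exact: TX.
have [x0 [s Ts sx]] := XT x Xx.
have st : s = t by apply: T_prim => //; rewrite -kxt dvdn_mull.
have := dvdn_leq x0 sx; rewrite st -kxt.
by rewrite leqNgt ltn_Pmull.
Qed.

End PrimeMultiples.

Theorem theorem1 (R : realType) (T : set nat) (T_pos : T `<=` posn)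
    (T_taut : taut R T) :
  exists B : set nat,
    [/\ B `<=` posn, besicovitch R B & tautification R B = T].
Proof.
have B_pos : prime_multiples T `<=` posn.
  by move=> _ [t [p [Tt p_pr _ ->]]]; rewrite /posn /= muln_gt0 (T_pos _ Tt) prime_gt0.
exists (prime_multiples T); split=> //; first exact: prime_multiples_besicovitch.
apply: prim_eq => // [t t' Tt Tt'|t Tt|x].
- exact: (taut_primitive T_taut).
- right; split; first exact: T_pos.
  exists [set p | prime p /\ t * t`! < p]; split; first exact: behrend_large_primes.
  by move=> _ [p [p_pr tp] <-]; exists t, p.
- case=> [Bx|Cx]; split; [exact: B_pos| |by case: Cx|].
    by case: Bx => t [p [Tt _ _ ->]]; exists t => //; exact: dvdn_mulr.
  exact: behrend_scales_prime_multiples Cx.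
Qed.
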